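(* Let $\phi$ be a function-free first-order sentence whose predicates are exactly $P_1,\dots,P_k$, let $(w,\bar w)$ be a weighting on $\phi$, and let $d$ be a domain size. For each $i$ put $r_i = d^{\mathsf{arity}(P_i)}$, and let $\mathcal{K} = \{(n_1,\dots,n_k)\in\mathbb{N}^k : n_i \in \{0,\dots,r_i\} \text{ for all } i\}$. Then $$\mathsf{WFOMC}(\phi,d,w,\bar w) = \sum_{(n_1,\dots,n_k)\in\mathcal{K}} \left[\prod_{i=1}^k w(P_i)^{n_i}\,\bar w(P_i)^{r_i-n_i}\right]\cdot \mathsf{FOMC}\big(\phi\land\phi^{CARD}_{(n_1,\dots,n_k)},d\big),$$ where $\phi^{CARD}_{(n_1,\dots,n_k)}$ denotes the cardinality constraint that a model has exactly $n_i$ true ground instances of $P_i$, for every $i=1,\dots,k$.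
   Context: First-order logic here is function-free and interpreted over the finite domain $\mathbf{D}=\{1,\dots,d\}$. A ground atom is $P(a_1,\dots,a_n)$ with $P$ a predicate of arity $n$ and $a_1,\dots,a_n\in\mathbf{D}$; an interpretation assigns true or false to each of the $d^{\mathsf{arity}(P)}$ ground atoms of each predicate $P$. $\mathsf{models}_d(\phi)$ is the set of interpretations (of the predicates of $\phi$) over $\mathbf{D}$ satisfying the sentence $\phi$. First-order model count: $\mathsf{FOMC}(\phi,d) = |\mathsf{models}_d(\phi)|$. For a sentence conjoined with a cardinality constraint, $\mathsf{FOMC}(\phi\land\phi^{CARD}_{(n_1,\dots,n_k)},d)$ is the number of $\omega\in\mathsf{models}_d(\phi)$ satisfying that constraint. Weighting: a weighting on $\phi$ is a pair of maps $w,\bar w$ from the set of predicates of $\phi$ to $\mathbb{R}$. Weighted first-order model count: $$\mathsf{WFOMC}(\phi,d,w,\bar w)=\sum_{\omega\in\mathsf{models}_d(\phi)}\ \prod_{l\in\omega_T} w(\mathsf{pred}(l))\prod_{l\in\omega_F}\bar w(\mathsf{pred}(l)),$$ where $\omega_T$ (resp. $\omega_F$) is the set of ground atoms true (resp. false) in $\omega$, and $\mathsf{pred}(l)$ is the predicate of the ground atom $l$. Convention: $0^0=1$. *)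

(* Defs.v *)
From HB Require Import structures.
From mathcomp Require Import all_boot all_order all_algebra.
From mathcomp Require Import reals.

Set Implicit Arguments.
Unset Strict Implicit.
Unset Printing Implicit Defensive.

Import GRing.Theory.
Local Open Scope ring_scope.

(* Function-free first-order logic with equality, over k predicates indexed by
   'I_k with arities ar, and with the elements of the domain {1, ..., d} (here
   'I_d) available as constants denoting themselves; a constant-free sentence
   is one in which [Const] does not occur.  Formulas are well scoped:
   [formula ar d n] has its free variables among n de Bruijn indices, index 0
   being bound by the innermost quantifier, so a sentence is a formula with
   n = 0.  The equality symbol is logical: it is not one of the k predicates
   and it carries no ground atoms. *)
Inductive term (d n : nat) : Type :=
| Var of 'I_n
| Const of 'I_d.

Arguments Var {d n}.
Arguments Const {d n}.

Inductive formula (k : nat) (ar : 'I_k -> nat) (d : nat) : nat -> Type :=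
| FTrue n : formula ar d n
| FFalse n : formula ar d n
| FAtom n (i : 'I_k) of (ar i).-tuple (term d n) : formula ar d n
| FEq n of term d n & term d n : formula ar d n
| FNot n of formula ar d n : formula ar d n
| FAnd n of formula ar d n & formula ar d n : formula ar d n
| FOr n of formula ar d n & formula ar d n : formula ar d n
| FImp n of formula ar d n & formula ar d n : formula ar d n
| FIff n of formula ar d n & formula ar d n : formula ar d n
| FAll n of formula ar d n.+1 : formula ar d n
| FEx n of formula ar d n.+1 : formula ar d n.

Definition sentence (k : nat) (ar : 'I_k -> nat) (d : nat) := formula ar d 0.

Fixpoint preds (k : nat) (ar : 'I_k -> nat) (d n : nat)
    (phi : formula ar d n) : {set 'I_k} :=
  match phi with
  | FTrue _ | FFalse _ | FEq _ _ _ => set0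
  | FAtom _ i _ => [set i]
  | FNot _ p => preds p
  | FAnd _ p q | FOr _ p q | FImp _ p q | FIff _ p q => preds p :|: preds q
  | FAll _ p | FEx _ p => preds p
  end.

Definition ground_atom (k : nat) (ar : 'I_k -> nat) (d : nat) :=
  {i : 'I_k & (ar i).-tuple 'I_d}.

Definition pred_of (k : nat) (ar : 'I_k -> nat) (d : nat)
  (l : ground_atom ar d) : 'I_k := tag l.

Notation interpretation ar d := {ffun ground_atom ar d -> bool}.

Definition eval_term (d n : nat) (e : n.-tuple 'I_d) (t : term d n) : 'I_d :=
  match t with
  | Var x => tnth e x
  | Const a => a
  end.

Fixpoint sat (k : nat) (ar : 'I_k -> nat) (d : nat) (om : interpretation ar d)
    (n : nat) (phi : formula ar d n) : n.-tuple 'I_d -> bool :=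
  match phi in formula _ _ n return n.-tuple 'I_d -> bool with
  | FTrue _ => fun=> true
  | FFalse _ => fun=> false
  | FAtom _ i ts => fun e =>
      om (Tagged (fun j => (ar j).-tuple 'I_d) (map_tuple (eval_term e) ts))
  | FEq _ s t => fun e => eval_term e s == eval_term e t
  | FNot _ p => fun e => ~~ sat om p e
  | FAnd _ p q => fun e => sat om p e && sat om q e
  | FOr _ p q => fun e => sat om p e || sat om q e
  | FImp _ p q => fun e => sat om p e ==> sat om q e
  | FIff _ p q => fun e => sat om p e == sat om q e
  | FAll _ p => fun e => [forall a : 'I_d, sat om p (cons_tuple a e)]
  | FEx _ p => fun e => [exists a : 'I_d, sat om p (cons_tuple a e)]
  end.

Section Counting.

Variables (k : nat) (ar : 'I_k -> nat) (d : nat).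

Definition models (phi : sentence ar d) : {set interpretation ar d} :=
  [set om | sat om phi [tuple]].

(* The constraint phi^CARD_(c_1, ..., c_k), as a property of interpretations. *)
Definition card_constraint (c : 'I_k -> nat) (om : interpretation ar d) : bool :=
  [forall i : 'I_k, #|[set l | om l & pred_of l == i]| == c i].

(* The first-order model count of phi conjoined with a cardinality constraint
   C, which is a predicate on interpretations rather than a formula. *)
Definition FOMC_card (phi : sentence ar d) (C : pred (interpretation ar d)) :
  nat := #|[set om in models phi | C om]|.

Definition WFOMC (R : realType) (phi : sentence ar d) (w wbar : 'I_k -> R) : R :=
  \sum_(om in models phi)
    (\prod_(l | om l) w (pred_of l)) * (\prod_(l | ~~ om l) wbar (pred_of l)).

End Counting.

(* Main.v *)
Require Import Defs.
From HB Require Import structures.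
From mathcomp Require Import all_boot all_order all_algebra.
From mathcomp Require Import reals.

Set Implicit Arguments.
Unset Strict Implicit.
Unset Printing Implicit Defensive.

Import GRing.Theory.
Local Open Scope ring_scope.

(** The weight of an interpretation depends only on how many ground atoms of each predicate it makes
    true: grouping the atoms by predicate turns the two products into powers ([weight_true_count]),
    and the false atoms of predicate [i] number [d ^ ar i] minus the true ones ([true_countC]).
    Partitioning the models by their vector of counts, each class contributes its common weight
    times its size. *)

Lemma card_pred_of (k : nat) (ar : 'I_k -> nat) (d : nat) (i : 'I_k) :
  #|[set l : ground_atom ar d | pred_of l == i]| = (d ^ ar i)%N.
Proof.
pose T j := ((ar j).-tuple 'I_d : Type).
have -> : [set l : ground_atom ar d | pred_of l == i] =
          [set (Tagged T t : ground_atom ar d) | t : (ar i).-tuple 'I_d].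
  apply/setP => -[j t]; rewrite inE /pred_of /=.
  apply/eqP/imsetP => [eq_ji | [s _ /(congr1 tag) //]].
  (* Eliminating the equality of tags gives [t] the type of an [ar i]-tuple. *)
  by case: _ / eq_ji; exists t.
rewrite card_imset => [|s t /eqP]; last by rewrite eq_Tagged => /eqP.
by rewrite card_tuple card_ord.
Qed.

(** Within the block of one predicate the factor is constant. An empty block gives exponent 0 and
    value 1, in accordance with the convention for zero to the power zero. *)
Lemma prod_pred_of (R : comPzSemiRingType) (k : nat) (ar : 'I_k -> nat)
    (d : nat) (w : 'I_k -> R) (P : pred (ground_atom ar d)) :
  \prod_(l | P l) w (pred_of l) =
  \prod_(i < k) w i ^+ #|[set l | P l & pred_of l == i]|.
Proof.
rewrite (partition_big (@pred_of k ar d) xpredT) //=; apply: eq_bigr => i _.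
rewrite (eq_bigr (fun=> w i)) => [|l /andP[_ /eqP ->] //].
by rewrite prodr_const cardsE.
Qed.

Definition true_count (k : nat) (ar : 'I_k -> nat) (d : nat)
    (om : interpretation ar d) (i : 'I_k) : nat :=
  #|[set l | om l & pred_of l == i]|.

Lemma true_countC (k : nat) (ar : 'I_k -> nat) (d : nat)
    (om : interpretation ar d) (i : 'I_k) :
  (true_count om i + #|[set l | ~~ om l & pred_of l == i]|)%N = (d ^ ar i)%N.
Proof.
rewrite -card_pred_of -[RHS](cardsID [set l | om l]); congr (_ + _)%N.
  by apply: eq_card => l; rewrite !inE andbC.
by apply: eq_card => l; rewrite !inE.
Qed.

Lemma weight_true_count (R : comPzSemiRingType) (k : nat) (ar : 'I_k -> nat)
    (d : nat) (w wbar : 'I_k -> R) (om : interpretation ar d) :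
  (\prod_(l | om l) w (pred_of l)) * (\prod_(l | ~~ om l) wbar (pred_of l)) =
  \prod_(i < k)
    (w i ^+ true_count om i * wbar i ^+ (d ^ ar i - true_count om i)).
Proof.
rewrite !prod_pred_of -big_split; apply: eq_bigr => i _ /=.
(* With [d ^ ar i] written as true plus false atoms, the truncated subtraction is exact. *)
by rewrite -(true_countC om) addKn.
Qed.

Theorem theorem2 (R : realType) (k : nat) (ar : 'I_k -> nat) (d : nat)
    (phi : sentence ar d) (hphi : preds phi = [set: 'I_k])
    (w wbar : 'I_k -> R) :
  WFOMC phi w wbar =
  \sum_(n : {dffun forall i : 'I_k, 'I_(d ^ ar i).+1})
    (\prod_(i < k) (w i ^+ n i * wbar i ^+ (d ^ ar i - n i)))
    * (FOMC_card phi (card_constraint (fun i => n i)))%:R.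
Proof.
(* The class of [om] is its vector of counts. The default value of [inord] never occurs, since a
   count is at most [d ^ ar i]. *)
pose c (om : interpretation ar d) : {dffun forall i, 'I_(d ^ ar i).+1} :=
  [ffun i => inord (true_count om i)].
have cE om i : c om i = true_count om i :> nat.
  by rewrite ffunE inordK // ltnS -(true_countC om) leq_addr.
rewrite /WFOMC (partition_big c xpredT) //=; apply: eq_bigr => n _.
have constraintE om : (c om == n) = card_constraint (fun i => n i) om.
  apply/eqP/forallP => [<- i | count_n]; first by rewrite cE.
  by apply/ffunP => i; apply: val_inj; rewrite /= cE; apply/eqP/count_n.
(* The weight times the count becomes a sum of that constant weight over the models in the class, to
   be compared term by term. *)
rewrite mulr_natr /FOMC_card cardsE -sumr_const.
apply: eq_big => [om | om /andP[_ /eqP <-]]; first by rewrite constraintE.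
by rewrite weight_true_count; apply: eq_bigr => i _; rewrite cE.
Qed.
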